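(* Let $K$ be an algebraically closed field of arbitrary characteristic, and let $f,g\in K[[x_1,\dots,x_n]]$ be such that $\mathrm{ord}(f)=s\ge 2$ and $\mu(f)<\infty$. Let $s'=\mathrm{ord}(\mathrm{j}(f))$. Then the following are equivalent: (i) $f$ and $g$ are right equivalent. (ii) $M_k(f)\cong M_k(g)$ as $K[[t]]$-algebras for some (equivalently, for all) $k\in\mathbb{N}$ such that $$\mathfrak{m}^{\left\lfloor \frac{k+s+s'+1}{2}\right\rfloor}\subset \mathfrak{m}^2\,\mathrm{j}(f).$$
   Context: $K[[\mathbf{x}]]=K[[x_1,\dots,x_n]]$ is the formal power series ring over $K$ with maximal ideal $\mathfrak{m}$; $\mathbb{N}$ includes $0$. For $h\in K[[\mathbf{x}]]$: the Jacobian ideal is $\mathrm{j}(h)=\langle \partial h/\partial x_1,\dots,\partial h/\partial x_n\rangle$; the Milnor algebra is $M(h)=K[[\mathbf{x}]]/\mathrm{j}(h)$; the Milnor number is $\mu(h)=\dim_K M(h)$. For $k\in\mathbb{N}$, the $k$-th Milnor algebra is $M_k(h)=K[[\mathbf{x}]]/\mathfrak{m}^k\mathrm{j}(h)$. It is regarded as a $K[[t]]$-algebra by letting $t$ act as multiplication by $h$; thus an isomorphism $M_k(f)\cong M_k(g)$ of $K[[t]]$-algebras is a $K$-algebra isomorphism sending the class of $f$ in $M_k(f)$ to the class of $g$ in $M_k(g)$. The order $\mathrm{ord}(h)$ is the maximal $l$ with $h\in\mathfrak{m}^l$; for an ideal $I\subset K[[\mathbf{x}]]$, $\mathrm{ord}(I)=\max\{l\in\mathbb{N}\mid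 I\subset\mathfrak{m}^l\}$. Two power series $f,g$ are right equivalent if there is a $K$-algebra automorphism $\varphi$ of $K[[\mathbf{x}]]$ with $g=\varphi(f)$. $\lfloor\cdot\rfloor$ denotes the floor (the largest integer not exceeding the argument). *)

(* Defs.v *)
From HB Require Import structures.
From mathcomp Require Import all_boot all_order all_algebra.
From mathcomp Require Import generic_quotient ring_quotient.
From mathcomp Require Import boolp classical_sets.
From mathcomp Require Import mpoly.

Set Implicit Arguments.
Unset Strict Implicit.
Unset Printing Implicit Defensive.

Import GRing.Theory.
Local Open Scope ring_scope.
Local Open Scope quotient_scope.

(* mseries n R is R[[x_1, ..., x_n]]: arbitrary families of coefficients
   indexed by the monomials 'X_{1..n}, with the Cauchy product. *)
Record mseries (n : nat) (R : Type) := MSeries { scoef : 'X_{1..n} -> R }.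

Section SeriesType.
Variables (n : nat) (R : Type).

Lemma mseriesP (f g : mseries n R) : scoef f =1 scoef g -> f = g.
Proof. by case: f => f; case: g => g /= /funext ->. Qed.

HB.instance Definition _ := gen_eqMixin (mseries n R).
HB.instance Definition _ := gen_choiceMixin (mseries n R).
End SeriesType.

Section SeriesZmodule.
Variables (n : nat) (R : zmodType).
Implicit Types f g h : mseries n R.

Definition series0 : mseries n R := MSeries (fun=> 0).
Definition seriesN f := MSeries (fun m => - scoef f m).
Definition seriesD f g := MSeries (fun m => scoef f m + scoef g m).

Fact seriesDA : associative seriesD.
Proof. by move=> f g h; apply/mseriesP => m /=; rewrite addrA. Qed.
Fact seriesDC : commutative seriesD.
Proof. by move=> f g; apply/mseriesP => m /=; rewrite addrC. Qed.
Fact series0D : left_id series0 seriesD.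
Proof. by move=> f; apply/mseriesP => m /=; rewrite add0r. Qed.
Fact seriesND : left_inverse series0 seriesN seriesD.
Proof. by move=> f; apply/mseriesP => m /=; rewrite addNr. Qed.

HB.instance Definition _ :=
  GRing.isZmodule.Build (mseries n R) seriesDA seriesDC series0D seriesND.
End SeriesZmodule.

Section SeriesAlgebra.
Variables (n : nat) (R : comNzRingType).
Implicit Types f g h : mseries n R.

Definition series1 : mseries n R := MSeries (fun m => (m == 0%MM)%:R).

Definition seriesM f g : mseries n R := MSeries (fun m =>
  \sum_(k : 'X_{1..n < (mdeg m).+1, (mdeg m).+1} | m == (k.1 + k.2)%MM)
     scoef f k.1 * scoef g k.2).

Definition series_scale (a : R) f : mseries n R :=
  MSeries (fun m => a * scoef f m).

Definition series_trunc (d : nat) f : {mpoly R[n]} :=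
  \sum_(m : 'X_{1..n < d}) scoef f m *: 'X_[m].

Lemma coef_trunc d f m : (mdeg m < d)%N -> (series_trunc d f)@_m = scoef f m.
Proof. exact: mcoeff_mpoly. Qed.

Lemma mcoeffM_congr (p p' q q' : {mpoly R[n]}) m :
    (forall k, (mdeg k <= mdeg m)%N -> p@_k = p'@_k) ->
    (forall k, (mdeg k <= mdeg m)%N -> q@_k = q'@_k) ->
  (p * q)@_m = (p' * q')@_m.
Proof.
move=> ep eq; rewrite !mcoeffM; apply: eq_bigr => k _.
by rewrite ep ?eq // -ltnS bmdeg.
Qed.

Lemma scoefM d f g m : (mdeg m < d)%N ->
  scoef (seriesM f g) m = (series_trunc d f * series_trunc d g)@_m.
Proof.
move=> md; rewrite mcoeffM; apply: eq_bigr => k _.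
by rewrite !coef_trunc // (leq_trans _ md) // bmdeg.
Qed.

Fact seriesMC : commutative seriesM.
Proof.
by move=> f g; apply/mseriesP => m; rewrite !(scoefM _ _ (ltnSn _)) mulrC.
Qed.

Fact seriesMA : associative seriesM.
Proof.
move=> f g h; apply/mseriesP => m; rewrite !(scoefM _ _ (ltnSn _)).
set d := (mdeg m).+1; set t := series_trunc d.
transitivity (t f * (t g * t h))@_m.
  by apply: mcoeffM_congr => // k km; rewrite coef_trunc // (@scoefM d).
rewrite mulrA; apply: mcoeffM_congr => // k km.
by rewrite coef_trunc // (@scoefM d).
Qed.

Fact series1M : left_id series1 seriesM.
Proof.
move=> f; apply/mseriesP => m; rewrite (scoefM _ _ (ltnSn _)).
rewrite -[RHS](coef_trunc _ (ltnSn _)) -[in RHS](mul1r (series_trunc _ f)).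
by apply: mcoeffM_congr => // k km; rewrite coef_trunc // mcoeff1.
Qed.

Fact seriesMDl : left_distributive seriesM +%R.
Proof.
move=> f g h; apply/mseriesP => m /=; rewrite -big_split /=.
by apply: eq_bigr => k _; rewrite mulrDl.
Qed.

Fact series1_neq0 : series1 != 0.
Proof.
by apply/eqP => /(congr1 (fun f => scoef f 0%MM))/eqP /=; rewrite eqxx oner_eq0.
Qed.

HB.instance Definition _ := GRing.Zmodule_isComNzRing.Build (mseries n R)
  seriesMA seriesMC series1M seriesMDl series1_neq0.

Fact series_scaleA a b f :
  series_scale a (series_scale b f) = series_scale (a * b) f.
Proof. by apply/mseriesP => m /=; rewrite mulrA. Qed.
Fact series_scale1 : left_id 1 series_scale.
Proof. by move=> f; apply/mseriesP => m /=; rewrite mul1r. Qed.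
Fact series_scaleDr : right_distributive series_scale +%R.
Proof. by move=> a f g; apply/mseriesP => m /=; rewrite mulrDr. Qed.
Fact series_scaleDl f : {morph series_scale^~ f : a b / a + b}.
Proof. by move=> a b; apply/mseriesP => m /=; rewrite mulrDl. Qed.

HB.instance Definition _ := GRing.Zmodule_isLmodule.Build R (mseries n R)
  series_scaleA series_scale1 series_scaleDr series_scaleDl.

Fact series_scaleAl (a : R) f g : a *: (f * g) = (a *: f) * g.
Proof.
apply/mseriesP => m /=; rewrite mulr_sumr.
by apply: eq_bigr => k _; rewrite mulrA.
Qed.

HB.instance Definition _ :=
  GRing.Lmodule_isLalgebra.Build R (mseries n R) series_scaleAl.
HB.instance Definition _ := GRing.Lalgebra_isComAlgebra.Build R (mseries n R).

(* d/dx_i sends c x^(m + e_i) to (m_i + 1) c x^m. *)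
Definition spderiv (i : 'I_n) f : mseries n R :=
  MSeries (fun m => scoef f (m + U_(i))%MM *+ (m i).+1).

End SeriesAlgebra.

(* Unlike ring_quotient's idealr, an ideal may be the whole ring here: the
   algebras M_k(g) below are allowed to be zero. *)
HB.mixin Record isMulAbsorbing (R : comNzRingType) (S : R -> bool) := {
  ideal_absorb : forall a, {in S, forall u, a * u \in S}
}.

#[short(type="ideal")]
HB.structure Definition Ideal (R : comNzRingType) :=
  {S of GRing.ZmodClosed R S & isMulAbsorbing R S}.

Section IdealOperations.
Variable R : comNzRingType.
Implicit Types (S : set R) (I J : ideal R).

Definition ideal_span S : R -> bool := fun x =>
  `[< exists (d : nat) (a s : 'I_d -> R),
        (forall i, S (s i)) /\ x = \sum_i a i * s i >].

Fact ideal_gen_absorb S a : {in ideal_span S, forall u, a * u \in ideal_span S}.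
Proof.
move=> u /asboolP[d [c [s [Ss ->]]]]; apply/asboolP.
exists d, (fun i => a * c i), s; split=> //; rewrite mulr_sumr.
by apply: eq_bigr => i _; rewrite mulrA.
Qed.

Fact ideal_gen_zmod S : zmod_closed (ideal_span S).
Proof.
split; first by apply/asboolP; exists 0%N, (fun=> 0), (fun=> 0); split;
  [case | rewrite big_ord0].
move=> u v Su /(ideal_gen_absorb (-1)); rewrite mulN1r.
move: (- v) => w /asboolP[d' [c' [s' [Ss' ->]]]] {v}.
have /asboolP[d [c [s [Ss ->]]]] := Su; apply/asboolP.
pose glue (g : 'I_d -> R) (g' : 'I_d' -> R) (i : 'I_(d + d')) :=
  match fintype.split i with inl j => g j | inr j => g' j end.
exists (d + d')%N, (glue c c'), (glue s s'); split=> [i|].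
  by rewrite /glue; case: fintype.split.
rewrite big_split_ord /glue; congr (_ + _); apply: eq_bigr => i _.
  by rewrite (unsplitK (inl i)).
by rewrite (unsplitK (inr i)).
Qed.

HB.instance Definition _ S :=
  GRing.isZmodClosed.Build R (ideal_span S) (ideal_gen_zmod S).
HB.instance Definition _ S :=
  isMulAbsorbing.Build R (ideal_span S) (@ideal_gen_absorb S).

Definition ideal_gen S : ideal R := Ideal.clone R (ideal_span S) _.

Definition ideal_mul I J : ideal R :=
  ideal_gen [set x | exists a b, [/\ a \in I, b \in J & x = a * b]]%classic.

Definition ideal_exp I (k : nat) : ideal R :=
  iter k (ideal_mul I) (ideal_gen setT).

End IdealOperations.

Section QuotientAlgebra.
Variables (K : comNzRingType) (A : comAlgType K) (I : ideal A).

Definition quotient_algebra := Quotient.quot I.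
Local Notation Q := quotient_algebra.

HB.instance Definition _ := GRing.Zmodule.on Q.
HB.instance Definition _ : EqQuotient A (Quotient.equiv I) Q :=
  EqQuotient.on Q.

Definition quotient_class : A -> Q := \pi_Q.

Let qeqP (x y : A) :
  reflect (quotient_class x = quotient_class y) (x - y \in I).
Proof. by apply: (iffP idP); rewrite Quotient.idealrBE => /eqP. Qed.

Let qind (P : Q -> Prop) : (forall x, P (quotient_class x)) -> forall q, P q.
Proof. by move=> Px; elim/quotW. Qed.

Let qD x y : quotient_class (x + y) = quotient_class x + quotient_class y.
Proof. exact: Quotient.pi_add. Qed.

Definition quotient_one : Q := quotient_class 1.
Definition quotient_mul (x y : Q) : Q := quotient_class (repr x * repr y).
Definition quotient_scale (a : K) (x : Q) : Q := quotient_class (a *: repr x).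

Let qrepr x : repr (quotient_class x) - x \in I.
Proof. by apply/qeqP; rewrite /quotient_class reprK. Qed.

Fact quotient_classM x y :
  quotient_class (x * y) = quotient_mul (quotient_class x) (quotient_class y).
Proof.
symmetry; apply/qeqP; set x' := repr _; set y' := repr _.
rewrite -[x' * y'](subrK (x' * y)) -mulrBr -addrA -mulrBl.
apply: rpredD; first by rewrite ideal_absorb ?qrepr.
by rewrite mulrC ideal_absorb ?qrepr.
Qed.

Fact quotient_classZ a x :
  quotient_class (a *: x) = quotient_scale a (quotient_class x).
Proof.
symmetry; apply/qeqP; rewrite -scalerBr -[_ - x]mul1r scalerAl.
by rewrite ideal_absorb ?qrepr.
Qed.

Fact quotient_mulA : associative quotient_mul.
Proof.
elim/qind=> x; elim/qind=> y; elim/qind=> z.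
by rewrite -!quotient_classM mulrA.
Qed.
Fact quotient_mulC : commutative quotient_mul.
Proof.
by elim/qind=> x; elim/qind=> y; rewrite -!quotient_classM mulrC.
Qed.
Fact quotient_mul1 : left_id quotient_one quotient_mul.
Proof. by elim/qind=> x; rewrite -quotient_classM mul1r. Qed.
Fact quotient_mulDl : left_distributive quotient_mul +%R.
Proof.
elim/qind=> x; elim/qind=> y; elim/qind=> z.
by rewrite -qD -!quotient_classM -qD mulrDl.
Qed.

HB.instance Definition _ := GRing.Zmodule_isComPzRing.Build Q
  quotient_mulA quotient_mulC quotient_mul1 quotient_mulDl.

Fact quotient_scaleA a b v :
  quotient_scale a (quotient_scale b v) = quotient_scale (a * b) v.
Proof. by elim/qind: v => x; rewrite -!quotient_classZ scalerA. Qed.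
Fact quotient_scale1 : left_id 1 quotient_scale.
Proof. by elim/qind=> x; rewrite -quotient_classZ scale1r. Qed.
Fact quotient_scaleDr : right_distributive quotient_scale +%R.
Proof.
move=> a; elim/qind=> x; elim/qind=> y.
by rewrite -qD -!quotient_classZ -qD scalerDr.
Qed.
Fact quotient_scaleDl v : {morph quotient_scale^~ v : a b / a + b}.
Proof.
by elim/qind: v => x a b; rewrite -!quotient_classZ -qD scalerDl.
Qed.

HB.instance Definition _ := GRing.Zmodule_isLmodule.Build K Q
  quotient_scaleA quotient_scale1 quotient_scaleDr quotient_scaleDl.

End QuotientAlgebra.

Definition has_dimension (K : fieldType) (V : lmodType K) (d : nat) : Prop :=
  exists e : 'I_d -> V,
    forall v, exists! c : {ffun 'I_d -> K}, v = \sum_i c i *: e i.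

Section Milnor.
Variables (n : nat) (K : fieldType).
Implicit Types (f g h : mseries n K) (I : ideal (mseries n K)).

Definition maxideal_pred : mseries n K -> bool := fun h => scoef h 0%MM == 0.

Fact maxideal_absorb a :
  {in maxideal_pred, forall u, a * u \in maxideal_pred}.
Proof.
move=> u /eqP u0; apply/eqP => /=; apply: big1 => k /eqP k0.
have /eqP : mdeg (k.1 + k.2)%MM = 0%N by rewrite -k0 mdeg0.
rewrite mdegD addn_eq0 => /andP[_]; rewrite mdeg_eq0 => /eqP ->.
by rewrite u0 mulr0.
Qed.

Fact maxideal_zmod : zmod_closed maxideal_pred.
Proof.
split=> [|u v /eqP u0 /eqP v0]; apply/eqP => //=.
by rewrite u0 v0 subr0.
Qed.

HB.instance Definition _ := GRing.isZmodClosed.Build _ _ maxideal_zmod.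
HB.instance Definition _ := isMulAbsorbing.Build _ _ maxideal_absorb.

Definition maxideal : ideal (mseries n K) :=
  Ideal.clone _ maxideal_pred _.

Fact maxideal_proper : 1 \notin maxideal.
Proof. by rewrite unfold_in /= /maxideal_pred /= eqxx oner_eq0. Qed.

Fact maxideal_maximal I :
  {subset maxideal <= I} -> 1 \notin I -> {subset I <= maxideal}.
Proof.
move=> mI I1 h Ih; apply: contraNT I1 => h0.
set c := scoef h 0%MM; have c0 : c != 0 by [].
have m_h : h - c%:A \in maxideal.
  by apply/eqP => /=; rewrite eqxx mulr1 subrr.
have Ic : c%:A \in I by rewrite -[c%:A](subKr h) rpredB // mI.
suff -> : 1 = c^-1 *: 1 * c%:A :> mseries n K by apply: ideal_absorb.
by rewrite -scalerAl mul1r scalerA mulVf // scale1r.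
Qed.

Definition jacobian f : ideal (mseries n K) :=
  ideal_gen (range (fun i : 'I_n => spderiv i f)).

Definition has_order h (l : nat) : Prop :=
  h \in ideal_exp maxideal l /\
  forall l', h \in ideal_exp maxideal l' -> (l' <= l)%N.

Definition has_ideal_order I (l : nat) : Prop :=
  {subset I <= ideal_exp maxideal l} /\
  forall l', {subset I <= ideal_exp maxideal l'} -> (l' <= l)%N.

Definition milnor_algebra f := quotient_algebra (jacobian f).

Definition has_milnor_number f (mu : nat) : Prop :=
  has_dimension (milnor_algebra f) mu.

Definition milnor_ideal (k : nat) f : ideal (mseries n K) :=
  ideal_mul (ideal_exp maxideal k) (jacobian f).

Definition milnor_algebra_k (k : nat) f := quotient_algebra (milnor_ideal k f).

Definition milnor_class (k : nat) f : mseries n K -> milnor_algebra_k k f :=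
  @quotient_class _ _ (milnor_ideal k f).

(* t acts on M_k(f) as multiplication by the class of f, so K[[t]]-linearity of
   a K-algebra isomorphism amounts to mapping the class of f to that of g. *)
Definition milnor_isomorphic (k : nat) f g : Prop :=
  exists phi : {rmorphism milnor_algebra_k k f -> milnor_algebra_k k g},
    [/\ bijective phi, scalable phi &
        phi (milnor_class k f f) = milnor_class k g g].

Definition right_equivalent f g : Prop :=
  exists phi : {lrmorphism mseries n K -> mseries n K},
    bijective phi /\ g = phi f.

End Milnor.

Arguments maxideal n K : clear implicits.

(* Main.v *)
Require Import Defs.
From HB Require Import structures.
From mathcomp Require Import all_boot all_order all_algebra.
From mathcomp Require Import generic_quotient ring_quotient.
From mathcomp Require Import boolp classical_sets.
From mathcomp Require Import mpoly ring zify.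

(** Write R = K[[x_1, ..., x_n]] with maximal ideal m. Right equivalence implies
    isomorphism of all the M_k: an automorphism phi with g = phi f preserves the
    powers of m, and by the chain rule it carries j(f) onto j(g), hence
    m^k j(f) onto m^k j(g) ([endo_milnor_ideal]).

    For the converse put q = (k + s + s' + 1) %/ 2. Comparing orders in
    m^q <= m^2 j(f) <= m^(2 + s') gives q >= s' + 2, and together with
    s' >= s - 1 this forces k >= 2. So both m^k j(f) and m^k j(g) lie in m^2, and
    an isomorphism M_k(f) -> M_k(g) lifts to an endomorphism phi of R with
    invertible linear part, simply by lifting the images of the variables
    ([quotient_iso_lift]). The class of f going to that of g means that
    phi f - g lies in m^k j(g), which is contained in m^(k + s').

    It remains to see that an automorphism sending f to g up to order
    N >= 2 q - s - 1 can be corrected to one sending f to g exactly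
    ([right_equivalent_of_approx]); the definition of q is tailored to make
    N = k + s' large enough. This is finite determinacy, proved by Newton's
    method, which works in every characteristic. If phi f - g has order M, then
    since phi (m^q) = m^q one can write g - phi f = sum b_i phi (d_i f) with b_i of
    order M - q + 2. Moving the images phi x_i by b_i cancels the error up to
    Taylor terms of degree two in b, of order 2 (M - q + 1) + s, and this is at least
    M + 1 exactly when M >= 2 q - s - 1. The images of the variables converge.

    The last ingredient is that an admissible k exists: a finite Milnor number
    forces some power of each variable, hence a power of m, into j(f)
    ([mpow_sub_of_finite_dim]).

    All this needs little calculus in R. Every K-algebra endomorphism of R
    respects the powers of m ([endo_mpow]), so it is determined by the images of the
    variables, these can be prescribed in m ([exists_endo]), and it is bijective as
    soon as its linear part is invertible ([inverse_function]). *)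

Set Implicit Arguments.
Unset Strict Implicit.
Unset Printing Implicit Defensive.

Import GRing.Theory.

(** * Generated ideals and products of ideals *)
Section Ideals.
Local Open Scope ring_scope.
Variable R : comNzRingType.
Implicit Types (S : set R) (I J L : ideal R).

Lemma mem_ideal_gen S x : S x -> x \in ideal_gen S.
Proof.
move=> Sx; apply/asboolP; exists 1%N, (fun=> 1), (fun=> x); split=> //.
by rewrite big_ord1 mul1r.
Qed.

Lemma ideal_gen_sub S J : (forall x, S x -> x \in J) -> {subset ideal_gen S <= J}.
Proof.
move=> SJ x /asboolP[d [a [s [Ss ->]]]].
by apply: rpred_sum => i _; rewrite ideal_absorb // SJ.
Qed.

Lemma mem_ideal_mul I J a b : a \in I -> b \in J -> a * b \in ideal_mul I J.
Proof. by move=> aI bJ; apply: mem_ideal_gen; exists a, b. Qed.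

(** The predicate need not be an ideal: the coefficient in front of a product
    a * b can be absorbed into a, so closure under sums suffices. *)
Lemma ideal_mul_ind I J (P : R -> Prop) :
    P 0 -> (forall x y, P x -> P y -> P (x + y)) ->
    (forall a b, a \in I -> b \in J -> P (a * b)) ->
  forall x, x \in ideal_mul I J -> P x.
Proof.
move=> P0 PD PM x /asboolP[d [c [s [Ss ->]]]].
elim/big_ind: _ => // i _; have [a [b [aI bJ ->]]] := Ss i.
by rewrite mulrA; apply: PM => //; rewrite ideal_absorb.
Qed.

Lemma ideal_mul_sub I J L :
    (forall a b, a \in I -> b \in J -> a * b \in L) ->
  {subset ideal_mul I J <= L}.
Proof.
by move=> IJL; apply: ideal_mul_ind => //; [apply: rpred0 | apply: rpredD].
Qed.

End Ideals.

(** * The filtration of K[[x]] by powers of the maximal ideal *)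
Section Filtration.
Local Open Scope ring_scope.
Variables (n : nat) (K : fieldType).
Local Notation R := (mseries n K).
Local Notation mpow := (ideal_exp (maxideal n K)).
Implicit Types (f g h u v w : R).

Lemma scoefD h u a : scoef (h + u) a = scoef h a + scoef u a.
Proof. by []. Qed.

Lemma scoefB h u a : scoef (h - u) a = scoef h a - scoef u a.
Proof. by []. Qed.

Lemma scoefZ c h a : scoef (c *: h) a = c * scoef h a.
Proof. by []. Qed.

Lemma scoef0 a : scoef (0 : R) a = 0.
Proof. by []. Qed.

Lemma scoef_sum I (r : seq I) (P : pred I) (F : I -> R) a :
  scoef (\sum_(i <- r | P i) F i) a = \sum_(i <- r | P i) scoef (F i) a.
Proof.
exact: (big_morph (fun h => scoef h a) (fun h u => scoefD h u a) (scoef0 a)).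
Qed.

(** Identities between polynomial series are computed in {mpoly K[n]} and
    transported along this morphism. *)
Definition series_of (p : {mpoly K[n]}) : R := MSeries (fun m => p@_m).

Fact series_of_zmod : zmod_morphism series_of.
Proof. by move=> p q; apply/mseriesP => m /=; rewrite mcoeffB. Qed.

Fact series_of_monoid : monoid_morphism series_of.
Proof.
split=> [|p q]; apply/mseriesP => m; first by rewrite /= mcoeff1.
rewrite [RHS](scoefM _ _ (ltnSn _)); apply: mcoeffM_congr => k km.
  by rewrite coef_trunc.
by rewrite coef_trunc.
Qed.

Fact series_of_scalable : scalable series_of.
Proof. by move=> c p; apply/mseriesP => m /=; rewrite mcoeffZ. Qed.

HB.instance Definition _ :=
  GRing.isZmodMorphism.Build {mpoly K[n]} R series_of series_of_zmod.
HB.instance Definition _ :=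
  GRing.isMonoidMorphism.Build {mpoly K[n]} R series_of series_of_monoid.
HB.instance Definition _ :=
  GRing.isScalable.Build K {mpoly K[n]} R *:%R series_of series_of_scalable.

Definition mono (a : 'X_{1..n}) : R := series_of 'X_[a].
Definition var (i : 'I_n) : R := mono U_(i).

Lemma scoef_mono a m : scoef (mono a) m = (a == m)%:R.
Proof. exact: mcoeffX. Qed.

Lemma mono0 : mono 0 = 1.
Proof. by rewrite /mono mpolyX0 rmorph1. Qed.

Lemma monoD a b : mono (a + b)%MM = mono a * mono b.
Proof. by rewrite /mono mpolyXD rmorphM. Qed.

Lemma scoef_varM i h m :
  scoef (var i * h) m = if (0 < m i)%N then scoef h (m - U_(i))%MM else 0.
Proof.
rewrite (scoefM _ _ (ltnSn _)).
transitivity (series_trunc (mdeg m).+1 h * 'X_[U_(i)])@_m.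
  rewrite mulrC; apply: mcoeffM_congr => // k km; rewrite coef_trunc //.
case: ifPn => [mi|].
  have Um : (U_(i) <= m)%MM.
    by apply/mnm_lepP => j; rewrite mnm1E; case: eqP => [<-|].
  have: (mdeg m < (mdeg m).+1)%N by []; move: {2 3}(mdeg m).+1 => D mD.
  rewrite -[in LHS](submK Um) addmC mcoeffMX coef_trunc //.
  by rewrite (leq_ltn_trans _ mD) ?mdegB.
rewrite -leqNgt leqn0 => /eqP mi; rewrite mcoeffM big1 // => k /eqP mk.
rewrite mcoeffX; case: eqP => [k2|]; last by rewrite mulr0.
move/(congr1 (fun x : 'X_{1..n} => x i)): mk.
by rewrite mi mnmDE -k2 mnm1E eqxx addn1.
Qed.

Lemma mdegS_split d (a : 'X_{1..n}) : mdeg a = d.+1 ->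
  exists i b, mdeg b = d /\ a = (U_(i) + b)%MM.
Proof.
move=> ad; have [i ai] : exists i, (0 < a i)%N.
  apply: contrapT => /forallNP a0; suff a00 : a = 0%MM by rewrite a00 mdeg0 in ad.
  by apply/mnmP => i; rewrite mnm0E; apply/eqP; rewrite -leqn0 leqNgt; apply/negP/a0.
have Ua : (U_(i) <= a)%MM.
  by apply/mnm_lepP => j; rewrite mnm1E; case: eqP => [<-|].
exists i, (a - U_(i))%MM; rewrite addmC submK //; split=> //.
by move: ad; rewrite -{1}(submK Ua) mdegD mdeg1 addn1 => -[].
Qed.

Lemma mono_ind (P : 'X_{1..n} -> Prop) :
  P 0%MM -> (forall i a, P a -> P (U_(i) + a)%MM) -> forall a, P a.
Proof.
move=> P0 PS a; move: {2}(mdeg a) (erefl (mdeg a)) => d.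
elim: d a => [|d IH] a ad; first by move/eqP: ad; rewrite mdeg_eq0 => /eqP->.
by have [i [b [bd ->]]] := mdegS_split ad; apply/PS/IH.
Qed.

Lemma mem_maxideal h : (h \in maxideal n K) = (scoef h 0%MM == 0).
Proof. by []. Qed.

(** Stated on coefficients rather than on powers of m, since it is what identifies
    those powers in [mpowP]. *)
Lemma scoefM_eq0 d e h u m : (forall a, (mdeg a < d)%N -> scoef h a = 0) ->
    (forall a, (mdeg a < e)%N -> scoef u a = 0) -> (mdeg m < d + e)%N ->
  scoef (h * u) m = 0.
Proof.
move=> hd ue md; apply: big1 => k /eqP mk.
have [k1|k1] := ltnP (mdeg k.1) d; first by rewrite hd // mul0r.
rewrite ue ?mulr0 // -(ltn_add2l d); apply: leq_ltn_trans md.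
by rewrite [leqRHS](congr1 (@mdeg n) mk) mdegD leq_add2r.
Qed.

(** Each monomial of positive degree is charged to the first variable that [pick]
    finds in it, so that the quotients by the variables do not overlap. *)
Lemma var_decomp d h : (forall a, (mdeg a < d.+1)%N -> scoef h a = 0) ->
  exists p : 'I_n -> R, h = \sum_i var i * p i /\
    forall i a, (mdeg a < d)%N -> scoef (p i) a = 0.
Proof.
move=> hd; pose lead (a : 'X_{1..n}) := [pick i | 0 < a i]%N.
pose part i : R := MSeries (fun a =>
if lead (a + U_(i))%MM == Some i then scoef h (a + U_(i))%MM else 0).
exists part; split=> [|i a ad]; last first.
  by rewrite /=; case: ifP => // _; apply: hd; rewrite mdegD mdeg1 addn1.
apply/mseriesP => a; rewrite scoef_sum.
under eq_bigr do rewrite scoef_varM.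
have [i ai|a0] := pickP (fun i => 0 < a i)%N; last first.
  rewrite big1 => [|i _]; last by rewrite a0.
  suff -> : a = 0%MM by rewrite hd // mdeg0.
  apply/mnmP => i; rewrite mnm0E; apply/eqP; rewrite -leqn0 leqNgt.
  by rewrite a0.
have la : lead a != None by rewrite /lead; case: pickP => // /(_ i); rewrite ai.
have subK j : (0 < a j)%N -> (a - U_(j) + U_(j) = a)%MM.
  move=> aj; apply/submK/mnm_lepP => l; rewrite mnm1E.
  by case: eqP => [<-|].
case lj: (lead a) la => [j|] // _.
have aj : (0 < a j)%N by move: lj; rewrite /lead; case: pickP => // x ax [<-].
rewrite (bigD1 j) //= aj subK // lj eqxx big1 ?addr0 // => l lj'.
case: ifP => // al; rewrite subK // lj; case: eqP => // -[jl].
by rewrite jl eqxx in lj'.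
Qed.

(** The algebraic powers of m coincide with the filtration by order, because m
    is generated by the variables; this is the form in which all estimates are
    made. *)
Lemma mpowP d h :
  h \in mpow d <-> (forall a, (mdeg a < d)%N -> scoef h a = 0).
Proof.
elim: d h => [|d IH] h; split=> //.
- by move=> _; apply: mem_ideal_gen.
- pose P u := forall a : 'X_{1..n}, (mdeg a < d.+1)%N -> scoef u a = 0.
  apply: (@ideal_mul_ind _ _ _ P) => [//|x y xd yd a ad|x y xm /IH yd a ad].
    by rewrite scoefD xd // yd // addr0.
  apply: (@scoefM_eq0 1 d) => // b; rewrite ltnS leqn0 mdeg_eq0 => /eqP->.
  by apply/eqP.
move=> /var_decomp[p [-> pd]]; apply: rpred_sum => i _; apply: mem_ideal_mul.
  by rewrite mem_maxideal scoef_mono mnm1_eq0.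
by apply/IH => a; apply: pd.
Qed.

Lemma mpow_vars d h : h \in mpow d.+1 ->
  exists p : 'I_n -> R, (forall i, p i \in mpow d) /\ h = \sum_i var i * p i.
Proof.
move=> /mpowP/var_decomp[p [-> pd]]; exists p; split=> // i.
by apply/mpowP => a; apply: pd.
Qed.

Lemma mpow1 h : (h \in mpow 1) = (scoef h 0%MM == 0).
Proof.
apply/idP/eqP => [/mpowP->//|h0]; first by rewrite mdeg0.
by apply/mpowP => a; rewrite ltnS leqn0 mdeg_eq0 => /eqP->.
Qed.

Lemma mpow0 h : h \in mpow 0.
Proof. exact/mpowP. Qed.

Lemma mpow_sub d e : (d <= e)%N -> {subset mpow e <= mpow d}.
Proof. by move=> de h /mpowP he; apply/mpowP => a ad; apply/he/(leq_trans ad). Qed.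

Lemma mpow_split d e h : h \in mpow (d + e) -> h \in ideal_mul (mpow d) (mpow e).
Proof.
elim: d h => [|d IH] h; first by move=> he; rewrite -[h]mul1r mem_ideal_mul ?mpow0.
pose L := ideal_mul (mpow d.+1) (mpow e).
apply: (@ideal_mul_ind _ _ _ (fun h => h \in L)) => [|x y xL yL|a b am /IH].
- exact: rpred0.
- exact: rpredD.
apply: (@ideal_mul_ind _ _ _ (fun b => a * b \in L)) => [|x y xL yL|c x cd xe].
- by rewrite mulr0 rpred0.
- by rewrite mulrDr rpredD.
by rewrite mulrA; apply: mem_ideal_mul => //; apply: mem_ideal_mul.
Qed.

Lemma mpow_mul d e h u : h \in mpow d -> u \in mpow e -> h * u \in mpow (d + e).
Proof. by move=> /mpowP hd /mpowP ue; apply/mpowP => a; apply: scoefM_eq0. Qed.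

Lemma mpow_mull d h u : u \in mpow d -> h * u \in mpow d.
Proof. exact: ideal_absorb. Qed.

Lemma mpow_scale d c h : h \in mpow d -> c *: h \in mpow d.
Proof. by move=> hd; rewrite -[h]mul1r scalerAl mpow_mull. Qed.

Lemma mpow_exp d k h : h \in mpow d -> h ^+ k \in mpow (d * k).
Proof.
move=> hd; elim: k => [|k IH]; first by rewrite muln0 mpow0.
by rewrite exprS mulnS mpow_mul.
Qed.

Lemma mpow_eq0 h : (forall d, h \in mpow d) -> h = 0.
Proof.
move=> h0; apply/mseriesP => a; rewrite scoef0.
by have /mpowP := h0 (mdeg a).+1; apply.
Qed.

Lemma mono_mpow a : mono a \in mpow (mdeg a).
Proof.
apply/mpowP => b ba; rewrite scoef_mono; case: eqP => // ab.
by rewrite ab ltnn in ba.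
Qed.

Lemma var_mpow i : var i \in mpow 1.
Proof. by rewrite -(mdeg1 i) mono_mpow. Qed.

Lemma trunc_mpow d h : h - series_of (series_trunc d h) \in mpow d.
Proof. by apply/mpowP => a ad; rewrite scoefB /= coef_trunc // subrr. Qed.

(** Density of polynomials: to prove a property that is closed under linear
    combinations and holds on some power of m, it is enough to check monomials. It
    replaces infinite sums throughout. *)
Lemma mpow_ind s D (P : R -> Prop) :
    (forall h, h \in mpow D -> P h) -> (forall h u, P h -> P u -> P (h + u)) ->
    (forall c h, P h -> P (c *: h)) ->
    (forall a, (s <= mdeg a)%N -> P (mono a)) ->
  forall h, h \in mpow s -> P h.
Proof.
move=> PD Padd PZ Pm h /mpowP hs; rewrite -(subrK (series_of (series_trunc D h)) h).
apply: (Padd); first exact/PD/trunc_mpow.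
rewrite rmorph_sum /=; elim/big_ind: _ => [||a _] //.
  by apply: PD; rewrite rpred0.
rewrite linearZ /=; have [am|am] := ltnP (mdeg a) s; last exact/PZ/Pm.
by rewrite hs // scale0r; apply: PD; rewrite rpred0.
Qed.

(** The coefficients of degree at most d are stationary from index d.+1 on, and
    the limit collects these stationary values. *)
Lemma mpow_complete (u : nat -> R) : (forall d, u d.+1 - u d \in mpow d) ->
  exists l, forall d, l - u d \in mpow d.
Proof.
move=> uC; have uD d e : (d <= e)%N -> u e - u d \in mpow d.
  move=> /subnKC <-; elim: (e - d)%N => [|k IH]; first by rewrite addn0 subrr rpred0.
  rewrite addnS -(subrK (u (d + k)%N) (u (d + k).+1)) -addrA rpredD //.
  exact/mpow_sub/uC/leq_addr.
exists (MSeries (fun a => scoef (u (mdeg a).+1) a)) => d.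
apply/mpowP => a ad; rewrite scoefB /=.
by apply/eqP; rewrite -oppr_eq0 opprB -scoefB; have /mpowP-> := uD _ _ ad.
Qed.

(** After scaling, h = 1 - r with r in m, and the geometric series inverts it. *)
Lemma series_unit h : scoef h 0%MM != 0 -> exists u, h * u = 1.
Proof.
move=> h0; set c := scoef h 0%MM in h0; pose r := 1 - c^-1 *: h.
have r1 : r \in mpow 1.
  by rewrite mpow1 /r /= eqxx mulVf // subrr.
have [u uP] : exists u, forall d, u - \sum_(i < d) r ^+ i \in mpow d.
  apply: (@mpow_complete (fun d => \sum_(i < d) r ^+ i)) => d.
  by rewrite big_ord_recr /= addrAC subrr add0r -{2}[d]mul1n mpow_exp.
have hr : h = c *: (1 - r) by rewrite /r subKr scalerA mulfV // scale1r.
exists (c^-1 *: u); rewrite {1}hr -scalerAl -scalerAr scalerA mulfV // scale1r.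
apply/eqP; rewrite -subr_eq0; apply/eqP/mpow_eq0 => d.
have -> : (1 - r) * u - 1 = (1 - r) * (u - \sum_(i < d) r ^+ i) - r ^+ d.
  rewrite mulrBr -addrA -opprD; congr (_ - _).
  by rewrite -opprB mulNr -subrX1 opprB subrK.
by rewrite rpredB ?mpow_mull // -{2}[d]mul1n mpow_exp.
Qed.

End Filtration.
Arguments mono {n K}.
Arguments var {n K}.

(** * Endomorphisms of K[[x]] *)
Section Endo.
Local Open Scope ring_scope.
Variables (n : nat) (K : fieldType).
Local Notation R := (mseries n K).
Local Notation mpow := (ideal_exp (maxideal n K)).
Implicit Types (f g h u v w : R) (phi psi : {lrmorphism R -> R}).

(** The morphism identities, with source and target both K[[x]], in the form used
    for rewriting below. *)
Lemma endoD phi h u : phi (h + u) = phi h + phi u.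
Proof. exact: rmorphD. Qed.

Lemma endoB phi h u : phi (h - u) = phi h - phi u.
Proof. exact: rmorphB. Qed.

Lemma endoM phi h u : phi (h * u) = phi h * phi u.
Proof. exact: rmorphM. Qed.

Lemma endo0 phi : phi 0 = 0.
Proof. exact: rmorph0. Qed.

Lemma endo1 phi : phi 1 = 1.
Proof. exact: rmorph1. Qed.

Lemma endoZ phi c h : phi (c *: h) = c *: phi h.
Proof. exact: linearZ. Qed.

Lemma endo_sum phi I (r : seq I) (P : pred I) (F : I -> R) :
  phi (\sum_(i <- r | P i) F i) = \sum_(i <- r | P i) phi (F i).
Proof. exact: rmorph_sum. Qed.

(** Continuity is automatic. If u lies in m but phi u has constant term c <> 0,
    then u - c is a unit, while its image phi u - c is not. *)
Lemma endo_mpow phi d h : h \in mpow d -> phi h \in mpow d.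
Proof.
have phi1 u : u \in mpow 1 -> phi u \in mpow 1.
  rewrite mpow1 => /eqP u0; rewrite mpow1; set c := scoef (phi u) _.
  apply: contraT => c0; have [|v uv] := @series_unit _ _ (u - c *: 1).
    by rewrite /= u0 sub0r eqxx mulr1 oppr_eq0.
  have : (phi u - c *: 1) * phi v \in mpow 1.
    by rewrite mulrC mpow_mull // mpow1 /= eqxx mulr1 subrr.
  move: (congr1 phi uv); rewrite endoM endoB endoZ endo1 => ->.
  by rewrite mpow1 /= eqxx oner_eq0.
elim: d h => [|d IH] h; first by rewrite !mpow0.
apply: (@ideal_mul_ind _ _ _ (fun h => phi h \in mpow d.+1)).
- by rewrite endo0 rpred0.
- by move=> x y xd yd; rewrite endoD rpredD.
by move=> a b a1 bd; rewrite endoM -add1n mpow_mul ?IH // phi1 // mpow1.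
Qed.

Lemma endo_ext phi psi :
  (forall i, phi (var i) = psi (var i)) -> phi =1 psi.
Proof.
move=> phipsi h; apply/eqP; rewrite -subr_eq0; apply/eqP/mpow_eq0 => d.
apply: (@mpow_ind _ _ 0 d (fun h => phi h - psi h \in mpow d)); last exact: mpow0.
- by move=> u ud; rewrite rpredB ?endo_mpow.
- by move=> u v ud vd; rewrite !endoD opprD addrACA rpredD.
- by move=> c u ud; rewrite !endoZ -scalerBr mpow_scale.
move=> a _; suff -> : phi (mono a) = psi (mono a) by rewrite subrr rpred0.
elim/mono_ind: a => [|i a IH]; first by rewrite mono0 !endo1.
by rewrite monoD !endoM IH phipsi.
Qed.

Section Substitution.
Variable y : 'I_n -> R.
Hypothesis y_mpow : forall i, y i \in mpow 1.

Let ev (p : {mpoly K[n]}) : R := mmap (in_alg R) y p.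

Let evB p q : ev (p - q) = ev p - ev q.
Proof. exact: rmorphB. Qed.

Let evM p q : ev (p * q) = ev p * ev q.
Proof. exact: rmorphM. Qed.

Lemma mmap1_mpow a : mmap1 y a \in mpow (mdeg a).
Proof.
rewrite /mmap1 mdegE; apply: (@big_ind2 _ _ (fun u d => u \in mpow d)).
- exact: mpow0.
- by move=> u d v e; apply: mpow_mul.
by move=> i _; have := mpow_exp (a i) (y_mpow i); rewrite mul1n.
Qed.

Lemma mmap_mpow d (p : {mpoly K[n]}) :
  (forall a, (mdeg a < d)%N -> p@_a = 0) -> ev p \in mpow d.
Proof.
move=> pd; rewrite /ev /mmap big_seq; apply: rpred_sum => a.
rewrite mcoeff_msupp => pa; apply: mpow_mull; apply: mpow_sub (mmap1_mpow a).
by rewrite leqNgt; apply: contra pa => ad; rewrite pd.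
Qed.

(** The coefficient at a only depends on h up to degree mdeg a, because y^b has
    order at least mdeg b; so each coefficient is read off a polynomial
    substitution. *)
Definition substitution h : R :=
  MSeries (fun a => scoef (ev (series_trunc (mdeg a).+1 h)) a).

Lemma substitution_trunc d h : substitution h - ev (series_trunc d h) \in mpow d.
Proof.
apply/mpowP => a ad; rewrite scoefB /= -scoefB -evB.
set p := series_trunc (mdeg a).+1 h; set p' := series_trunc d h.
have /mpowP -> // : ev (p - p') \in mpow (mdeg a).+1.
apply: mmap_mpow => b ba; rewrite mcoeffB !coef_trunc ?subrr //.
by rewrite (leq_trans ba).
Qed.

(** Reduces identities of power series to identities between the polynomial
    substitutions of truncations. *)
Lemma substitution_unique h u :
    (forall d, exists2 p, u - ev p \in mpow d &
       forall a, (mdeg a < d)%N -> p@_a = scoef h a) ->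
  substitution h = u.
Proof.
move=> hu; apply/eqP; rewrite -subr_eq0; apply/eqP/mpow_eq0 => d.
have [p up ph] := hu d.
set t := series_trunc d h.
have -> : substitution h - u = (substitution h - ev t) + ev (t - p) - (u - ev p).
  by rewrite evB; ring.
rewrite rpredB // rpredD ?substitution_trunc //; apply: mmap_mpow => a ad.
by rewrite mcoeffB ph // coef_trunc // subrr.
Qed.

(** K[[x]] is free on the variables as a complete local K-algebra. *)
Lemma exists_endo :
  exists phi : {lrmorphism R -> R}, forall i, phi (var i) = y i.
Proof.
have sB : zmod_morphism substitution.
  move=> h u; apply: substitution_unique => d.
  exists (series_trunc d h - series_trunc d u) => [|a ad].
    by rewrite evB opprD addrACA -opprD rpredB ?substitution_trunc.
  by rewrite mcoeffB !coef_trunc.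
have sM : monoid_morphism substitution.
  split=> [|h u]; apply: substitution_unique => d.
    by exists 1 => [|a ad]; rewrite ?mcoeff1 // /ev rmorph1 subrr rpred0.
  exists (series_trunc d h * series_trunc d u) => [|a ad]; last by rewrite -scoefM.
  rewrite evM; set p := ev _; set q := ev _.
  have -> : substitution h * substitution u - p * q
      = substitution u * (substitution h - p) + p * (substitution u - q) by ring.
  by rewrite rpredD // mpow_mull // substitution_trunc.
have sZ : scalable substitution.
  move=> c h; apply: substitution_unique => d.
  exists (c *: series_trunc d h) => [|a ad].
    rewrite /ev mmapZ /= mulr_algl -scalerBr mpow_scale //.
    exact: substitution_trunc.
  by rewrite mcoeffZ coef_trunc.
pose phi : {lrmorphism R -> R} := HB.pack substitution
  (GRing.isZmodMorphism.Build _ _ substitution sB)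
  (GRing.isMonoidMorphism.Build _ _ substitution sM)
  (GRing.isScalable.Build _ _ _ _ substitution sZ).
exists phi => i; apply: substitution_unique => d; exists 'X_i => //.
by rewrite /ev mmapX mmap1U subrr rpred0.
Qed.

End Substitution.
End Endo.

(** * The inverse function theorem *)
Section Inverse.
Local Open Scope ring_scope.
Variables (n : nat) (K : fieldType).
Local Notation R := (mseries n K).
Local Notation mpow := (ideal_exp (maxideal n K)).
Implicit Types (f g h u v w : R) (phi psi : {lrmorphism R -> R}).

Lemma endo_inv phi : bijective phi ->
  exists psi : {lrmorphism R -> R}, cancel phi psi /\ cancel psi phi.
Proof.
move=> [psi phiK psiK].
have sB : zmod_morphism psi by apply: can2_zmod_morphism phiK psiK.
have sM : monoid_morphism psi by apply: can2_monoid_morphism phiK psiK.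
have sZ : scalable psi by apply: can2_scalable phiK psiK.
pose psi' : {lrmorphism R -> R} := HB.pack psi
  (GRing.isZmodMorphism.Build _ _ psi sB)
  (GRing.isMonoidMorphism.Build _ _ psi sM)
  (GRing.isScalable.Build _ _ _ _ psi sZ).
by exists psi'.
Qed.

Definition linear_part phi : 'M[K]_n :=
  \matrix_(i, j) scoef (phi (var i)) U_(j)%MM.

Lemma mpow2P h : h \in mpow 2 <->
  scoef h 0%MM = 0 /\ forall i, scoef h U_(i)%MM = 0.
Proof.
split=> [/mpowP h2|[h0 h1]].
  by split=> [|i]; apply: h2; rewrite ?mdeg0 ?mdeg1.
apply/mpowP => a; case da : (mdeg a) => [|[|d]] // _.
  by move/eqP: da; rewrite mdeg_eq0 => /eqP->.
by have /mdeg1P[i /eqP->] : mdeg a == 1 by rewrite da.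
Qed.

Lemma scoef_vars (c : 'I_n -> K) j : scoef (\sum_i c i *: var i) U_(j)%MM = c j.
Proof.
rewrite scoef_sum (bigD1 j) //= mcoeffXU eqxx mulr1 big1 ?addr0 // => i ij.
by rewrite mcoeffXU (negbTE ij) mulr0.
Qed.

Lemma scoef_endo phi v j : v \in mpow 1 ->
  scoef (phi v) U_(j)%MM = \sum_i scoef v U_(i)%MM * linear_part phi i j.
Proof.
move=> /[dup] v1; rewrite mpow1 => /eqP v0.
pose l := \sum_i scoef v U_(i)%MM *: var i.
have vl : v - l \in mpow 2.
  apply/mpow2P; split=> [|i]; last by rewrite scoefB scoef_vars subrr.
  rewrite scoefB scoef_sum v0 big1 ?subrr // => i _.
  by rewrite scoefZ scoef_mono mnm1_eq0 mulr0.
have /mpow2P[_ /(_ j)] := endo_mpow phi vl; rewrite endoB scoefB => /eqP.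
rewrite subr_eq0 => /eqP->; rewrite endo_sum scoef_sum; apply: eq_bigr => i _.
by rewrite endoZ scoefZ mxE.
Qed.

(** On m^d / m^(d+1) this is the d-th symmetric power of the linear part; it
    follows from degree one by multiplicativity. *)
Lemma graded_surj phi : linear_part phi \in unitmx -> forall d h, h \in mpow d ->
  exists2 v, v \in mpow d & h - phi v \in mpow d.+1.
Proof.
move=> phiU.
have gr0 h : exists2 v, v \in mpow 0 & h - phi v \in mpow 1.
  exists (scoef h 0%MM *: 1); first exact: mpow0.
  by rewrite endoZ endo1 mpow1 /= eqxx mulr1 subrr.
have gr1 h : h \in mpow 1 -> exists2 v, v \in mpow 1 & h - phi v \in mpow 2.
  move=> h1; pose c := (\row_j scoef h U_(j)%MM) *m invmx (linear_part phi).
  have v1 : \sum_i c 0 i *: var i \in mpow 1.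
    by apply: rpred_sum => i _; rewrite mpow_scale ?var_mpow.
  exists (\sum_i c 0 i *: var i) => //; apply/mpow2P; split=> [|j].
    by apply/eqP; rewrite -mpow1 rpredB // endo_mpow.
  rewrite scoefB scoef_endo //.
  have : c *m linear_part phi = \row_j scoef h U_(j)%MM by rewrite mulmxKV.
  move/(congr1 (fun M : 'rV_n => M 0 j)); rewrite !mxE => <-.
  apply/eqP; rewrite subr_eq0; apply/eqP/eq_bigr => i _; congr (_ * _).
  by rewrite scoef_vars.
elim=> [|d IH] h; first by move=> _; apply: gr0.
apply: (@ideal_mul_ind _ _ _
  (fun h => exists2 v, v \in mpow d.+1 & h - phi v \in mpow d.+2)).
- by exists 0; rewrite ?endo0 ?subr0 rpred0.
- move=> x y [v vd xv] [w wd yw]; exists (v + w); first by rewrite rpredD.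
  by rewrite endoD opprD addrACA rpredD.
move=> a b; rewrite mem_maxideal -mpow1 => /gr1[v v1 av] /IH[w wd bw].
exists (v * w); first by rewrite -add1n mpow_mul.
have -> : a * b - phi (v * w) = (a - phi v) * b + phi v * (b - phi w).
  by rewrite endoM; ring.
rewrite rpredD //; last by rewrite -(add1n d.+1) mpow_mul ?endo_mpow.
rewrite -add2n mpow_mul //; have -> : b = b - phi w + phi w by rewrite subrK.
by rewrite rpredD ?endo_mpow // (mpow_sub _ bw).
Qed.

(** Successive approximation: the remainders r k of order e + k are corrected
    one degree at a time by [graded_surj], and the corrections sum up. *)
Lemma mpow_surj phi : linear_part phi \in unitmx -> forall e h, h \in mpow e ->
  exists2 v, v \in mpow e & phi v = h.
Proof.
move=> phiU e h he.
have /choice[F FP] (x : nat * R) : exists v, x.2 \in mpow x.1 ->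
    v \in mpow x.1 /\ x.2 - phi v \in mpow x.1.+1.
  have [xd|] := boolP (x.2 \in mpow x.1); last by exists 0.
  by have [v] := graded_surj phiU xd; exists v.
pose r := fix r k := if k is k'.+1 then r k' - phi (F ((e + k')%N, r k')) else h.
have rk k : r k \in mpow (e + k).
  elim: k => [|k IH]; first by rewrite addn0.
  by rewrite addnS; have [] := FP ((e + k)%N, r k) IH.
pose u k := \sum_(j < k) F ((e + j)%N, r j).
have Fk k : F ((e + k)%N, r k) \in mpow (e + k).
  by have [] := FP ((e + k)%N, r k) (rk k).
have ru k : h - phi (u k) = r k.
  elim: k => [|k IH]; first by rewrite /u big_ord0 endo0 subr0.
  by rewrite /u big_ord_recr /= endoD opprD addrA IH.
have [l lP] : exists l, forall d, l - u d \in mpow d.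
  apply: mpow_complete => d; rewrite /u big_ord_recr /= addrAC subrr add0r.
  by apply: mpow_sub (Fk d); rewrite leq_addl.
exists l.
  rewrite -(subrK (u e) l) rpredD //; apply: rpred_sum => j _.
  by apply: mpow_sub (Fk j); rewrite leq_addr.
apply/eqP; rewrite -subr_eq0 -oppr_eq0 opprB; apply/eqP/mpow_eq0 => d.
have -> : h - phi l = r d - phi (l - u d) by rewrite -ru endoB; ring.
by rewrite rpredB ?endo_mpow // (mpow_sub _ (rk d)) ?leq_addl.
Qed.

(** Preimages of the variables define an endomorphism psi with phi \o psi = id.
    Its linear part is the inverse matrix, so psi is surjective too; having a left
    inverse, it is bijective, with inverse phi. *)
Lemma inverse_function phi : linear_part phi \in unitmx -> bijective phi.
Proof.
move=> phiU.
have /choice[z zP] i : exists v, v \in mpow 1 /\ phi v = var i.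
  by have [v] := mpow_surj phiU (var_mpow K i); exists v.
have [psi psiE] := exists_endo (fun i => (zP i).1).
have psiK : cancel psi phi.
  move=> h; pose id' : {lrmorphism R -> R} := idfun.
  apply: (@endo_ext _ _ (phi \o psi) id') => i /=.
  by rewrite psiE (zP i).2.
have psiU : linear_part psi \in unitmx.
  suff /mulmx1_unit[? _] : linear_part psi *m linear_part phi = 1%:M by [].
  apply/matrixP => i j; rewrite mxE [RHS]mxE.
  have := scoef_endo phi j (zP i).1; rewrite (zP i).2 scoef_mono eq_mnm1 => ->.
  by apply: eq_bigr => l _; rewrite mxE psiE.
exists psi => // h; have [v _ <-] := mpow_surj psiU (mpow0 h).
by rewrite psiK.
Qed.

End Inverse.

(** * Derivatives, the chain rule and Taylor expansion *)
Section Derivative.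
Local Open Scope ring_scope.
Variables (n : nat) (K : fieldType).
Local Notation R := (mseries n K).
Local Notation mpow := (ideal_exp (maxideal n K)).
Implicit Types (f g h u v w : R) (phi psi : {lrmorphism R -> R}).

Lemma spderivD i h u : spderiv i (h + u) = spderiv i h + spderiv i u.
Proof. by apply/mseriesP => a /=; rewrite mulrnDl. Qed.

Lemma spderivZ i c h : spderiv i (c *: h) = c *: spderiv i h.
Proof. by apply/mseriesP => a /=; rewrite mulrnAr. Qed.

Lemma spderiv_mpow i d h : h \in mpow d.+1 -> spderiv i h \in mpow d.
Proof.
move=> /mpowP hd; apply/mpowP => a ad /=; rewrite hd ?mul0rn //.
by rewrite mdegD mdeg1 addn1.
Qed.

Lemma spderiv_series_of i (p : {mpoly K[n]}) :
  spderiv i (series_of p) = series_of p^`M(i).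
Proof. by apply/mseriesP => a /=; rewrite mcoeff_deriv. Qed.

Lemma spderiv1 i : spderiv i (1 : R) = 0.
Proof.
rewrite -(rmorph1 (@series_of n K)) spderiv_series_of.
by rewrite -mpolyC1 mderivC rmorph0.
Qed.

Lemma spderiv_var i j : spderiv i (var j : R) = (i == j)%:R.
Proof.
rewrite /var /mono spderiv_series_of mderivX mnm1E.
case: eqVneq => [->|ij]; last by rewrite scale0r rmorph0.
rewrite scale1r (_ : (U_(i) - U_(i))%MM = 0%MM) ?mpolyX0 ?rmorph1 //.
by apply/mnmP => l; rewrite mnmBE subnn mnm0E.
Qed.

(** Both sides are bilinear and lower orders by at most one, so the identity
    reduces by density to monomials, hence to polynomials. *)
Lemma spderivM i h u :
  spderiv i (h * u) = spderiv i h * u + h * spderiv i u.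
Proof.
apply/eqP; rewrite -subr_eq0; apply/eqP/mpow_eq0 => d.
pose E h u := spderiv i (h * u) - (spderiv i h * u + h * spderiv i u).
have EC v w : E v w = E w v by rewrite /E (mulrC v) addrC; ring.
have ED v w x : E (v + w) x = E v x + E w x.
  by rewrite /E mulrDl !spderivD; ring.
have EZ c v w : E (c *: v) w = c *: E v w.
  by rewrite /E -scalerAl !spderivZ -!scalerAl -scalerDr -scalerBr.
have Emx v w : v \in mpow d.+1 -> E v w \in mpow d.
  move=> vd; rewrite rpredB ?spderiv_mpow ?[v * w]mulrC ?mpow_mull //.
  rewrite rpredD // mulrC mpow_mull ?spderiv_mpow //.
  by rewrite (mpow_sub _ vd).
apply: (@mpow_ind _ _ 0 d.+1 (fun h => E h u \in mpow d)); last exact: mpow0.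
- by move=> v; apply: Emx.
- by move=> v w vd wd; rewrite ED rpredD.
- by move=> c v vd; rewrite EZ mpow_scale.
move=> a _; rewrite EC.
apply: (@mpow_ind _ _ 0 d.+1 (fun u => E u (mono a) \in mpow d)); last exact: mpow0.
- by move=> v; apply: Emx.
- by move=> v w vd wd; rewrite ED rpredD.
- by move=> c v vd; rewrite EZ mpow_scale.
move=> b _; rewrite /E /mono -rmorphM !spderiv_series_of mderivM rmorphD !rmorphM /=.
by rewrite subrr rpred0.
Qed.

(** Both sides are derivations along phi that agree on the variables, so they
    agree on monomials and then everywhere by density. *)
Lemma chain_rule phi i h : spderiv i (phi h) =
  \sum_j phi (spderiv j h) * spderiv i (phi (var j)).
Proof.
apply/eqP; rewrite -subr_eq0; apply/eqP/mpow_eq0 => d.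
pose E h := spderiv i (phi h) - \sum_j phi (spderiv j h) * spderiv i (phi (var j)).
apply: (@mpow_ind _ _ 0 d.+1 (fun h => E h \in mpow d)); last exact: mpow0.
- move=> v vd; rewrite rpredB ?spderiv_mpow ?endo_mpow //.
  by apply: rpred_sum => j _; rewrite mulrC mpow_mull ?endo_mpow ?spderiv_mpow.
- move=> v w vd wd; suff -> : E (v + w) = E v + E w by rewrite rpredD.
  rewrite /E endoD spderivD addrACA -opprD -big_split; congr (_ - _).
  by apply: eq_bigr => j _; rewrite spderivD endoD mulrDl.
- move=> c v vd; suff -> : E (c *: v) = c *: E v by rewrite mpow_scale.
  rewrite /E endoZ spderivZ scalerBr scaler_sumr; congr (_ - _).
  by apply: eq_bigr => j _; rewrite spderivZ endoZ scalerAl.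
move=> a _; suff -> : E (mono a) = 0 by rewrite rpred0.
elim/mono_ind: a => [|l a]; rewrite /E.
  rewrite mono0 endo1 spderiv1 big1 ?subrr // => j _.
  by rewrite spderiv1 endo0 mul0r.
move/eqP; rewrite subr_eq0 => /eqP IH; apply/eqP; rewrite subr_eq0; apply/eqP.
rewrite monoD endoM spderivM IH mulr_sumr.
under [RHS]eq_bigr => j _ do rewrite spderivM spderiv_var endoD !endoM mulrDl.
rewrite big_split /=; congr (_ + _); last by apply: eq_bigr => j _; rewrite mulrA.
rewrite (bigD1 l) //= eqxx endo1 mul1r mulrC big1 ?addr0 // => j jl.
by rewrite (negbTE jl) endo0 !mul0r.
Qed.

Lemma taylor1 phi psi t s h :
    (forall i, psi (var i) - phi (var i) \in mpow t.+1) -> h \in mpow s ->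
  psi h - phi h \in mpow (t + s).
Proof.
move=> bt.
apply: (@mpow_ind _ _ s (t + s) (fun h => psi h - phi h \in mpow (t + s))).
- by move=> v vd; rewrite rpredB ?endo_mpow.
- by move=> v w vd wd; rewrite !endoD opprD addrACA rpredD.
- by move=> c v vd; rewrite !endoZ -scalerBr mpow_scale.
move=> a sa; apply: (@mpow_sub _ _ _ (t + mdeg a)); first by rewrite leq_add2l.
elim/mono_ind: a {sa} => [|i a IH]; first by rewrite mono0 !endo1 subrr rpred0.
rewrite monoD !endoM mdegD mdeg1.
have -> : psi (var i) * psi (mono a) - phi (var i) * phi (mono a)
  = phi (var i) * (psi (mono a) - phi (mono a))
    + (psi (var i) - phi (var i)) * psi (mono a) by ring.
rewrite addnCA rpredD //; first by rewrite mpow_mul ?endo_mpow ?var_mpow.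
by rewrite addnA add1n mpow_mul ?endo_mpow ?mono_mpow.
Qed.

(** The Taylor remainder of degree two, estimated without dividing by 2: on a
    product with a variable the remainder T satisfies
    T (x_j h) = phi x_j * T h + b_j (psi h - phi h), where b_j = psi x_j - phi x_j,
    and [taylor1] bounds the last factor. *)
Lemma taylor2 phi psi t s h :
    (forall i, psi (var i) - phi (var i) \in mpow t.+1) -> h \in mpow s ->
  psi h - phi h - \sum_i (psi (var i) - phi (var i)) * phi (spderiv i h)
    \in mpow (t + t + s).
Proof.
move=> bt; pose T h := psi h - phi h
  - \sum_i (psi (var i) - phi (var i)) * phi (spderiv i h).
apply: (@mpow_ind _ _ s (t + t + s).+1 (fun h => T h \in mpow (t + t + s))).
- move=> v vd; have vd' := mpow_sub (leqnSn _) vd; rewrite !rpredB ?endo_mpow //.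
  by apply: rpred_sum => i _; rewrite mpow_mull ?endo_mpow ?spderiv_mpow.
- move=> v w vd wd; suff -> : T (v + w) = T v + T w by rewrite rpredD.
  rewrite /T !endoD; under eq_bigr do rewrite spderivD endoD mulrDr.
  by rewrite big_split /=; ring.
- move=> c v vd; suff -> : T (c *: v) = c *: T v by rewrite mpow_scale.
  rewrite /T !endoZ; under eq_bigr do rewrite spderivZ endoZ -scalerAr.
  by rewrite -scaler_sumr -!scalerBr.
move=> a sa; apply: (@mpow_sub _ _ _ (t + t + mdeg a)); first by rewrite leq_add2l.
elim/mono_ind: a {sa} => [|j a IH].
  rewrite /T mono0 !endo1 subrr big1 ?subrr ?rpred0 // => i _.
  by rewrite spderiv1 endo0 mulr0.
have -> : T (mono (U_(j) + a)%MM) = phi (var j) * T (mono a)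
    + (psi (var j) - phi (var j)) * (psi (mono a) - phi (mono a)).
  rewrite /T monoD !endoM.
  under eq_bigr => i _ do rewrite spderivM spderiv_var endoD !endoM mulrDr.
  rewrite big_split /= (bigD1 j) //= eqxx endo1 mul1r.
  rewrite [\sum_(i | i != j) _]big1 ?addr0 => [|i /negbTE ij]; last first.
    by rewrite ij endo0 mul0r mulr0.
  under [X in _ - (_ + X)]eq_bigr => i _ do rewrite mulrCA.
  by rewrite -mulr_sumr; ring.
rewrite mdegD mdeg1 addnCA rpredD //; first by rewrite mpow_mul ?endo_mpow ?var_mpow.
rewrite addnA add1n -addSn -addnA mpow_mul //.
exact: taylor1 (mono_mpow K a).
Qed.

End Derivative.

(** * Newton's method and finite determinacy *)
Section Determinacy.
Local Open Scope ring_scope.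
Variables (n : nat) (K : fieldType).
Local Notation R := (mseries n K).
Local Notation mpow := (ideal_exp (maxideal n K)).
Implicit Types (f g h u v w : R) (phi psi : {lrmorphism R -> R}).

Lemma spderiv_jacobian f i : spderiv i f \in jacobian f.
Proof. by apply: mem_ideal_gen; exists i. Qed.

Lemma jacobian_comb f h : h \in jacobian f ->
  exists a : 'I_n -> R, h = \sum_i a i * spderiv i f.
Proof.
move=> /asboolP[d [c [s [Ss ->]]]]; elim/big_ind: _ => [|x y [a ->] [b ->]|l _].
- by exists (fun=> 0); rewrite big1 // => i _; rewrite mul0r.
- exists (fun i => a i + b i); rewrite -big_split.
  by apply: eq_bigr => i _; rewrite mulrDl.
have [i _ <-] := Ss l; exists (fun j => if j == i then c l else 0).
rewrite (bigD1 i) //= eqxx big1 ?addr0 // => j /negbTE->.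
by rewrite mul0r.
Qed.

Lemma mul_jacobian_comb t f h : h \in ideal_mul (mpow t) (jacobian f) ->
  exists a : 'I_n -> R, (forall i, a i \in mpow t) /\ h = \sum_i a i * spderiv i f.
Proof.
move: h; apply: ideal_mul_ind => [|x y [a [at_ ->]] [b [bt ->]]|x y xt].
- exists (fun=> 0); split=> [i|]; first exact: rpred0.
  by rewrite big1 // => i _; rewrite mul0r.
- exists (fun i => a i + b i); split=> [i|]; first by rewrite rpredD.
  by rewrite -big_split; apply: eq_bigr => i _; rewrite mulrDl.
move=> /jacobian_comb[a ->]; exists (fun i => a i * x); split=> [i|].
  exact: mpow_mull.
by rewrite mulr_sumr; apply: eq_bigr => i _; rewrite mulrCA mulrA.
Qed.

(** The hypothesis on f is transported by phi because phi maps m^q onto m^q. *)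
Lemma pullback_jacobian phi f q c h :
    linear_part phi \in unitmx ->
    {subset mpow q <= ideal_mul (mpow 2) (jacobian f)} -> h \in mpow (c + q) ->
  exists b : 'I_n -> R,
    (forall i, b i \in mpow (c + 2)) /\ h = \sum_i b i * phi (spderiv i f).
Proof.
move=> phiU qf /mpow_split; move: h.
apply: ideal_mul_ind => [|x y [a [at_ ->]] [b [bt ->]]|x y xc yq].
- exists (fun=> 0); split=> [i|]; first exact: rpred0.
  by rewrite big1 // => i _; rewrite mul0r.
- exists (fun i => a i + b i); split=> [i|]; first by rewrite rpredD.
  by rewrite -big_split; apply: eq_bigr => i _; rewrite mulrDl.
have [v /qf/mul_jacobian_comb[a [a2 ->]] <-] := mpow_surj phiU yq.
exists (fun i => x * phi (a i)); split=> [i|]; first by rewrite mpow_mul ?endo_mpow.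
rewrite endo_sum mulr_sumr; apply: eq_bigr => i _.
by rewrite endoM mulrA.
Qed.

Lemma eq_linear_part phi psi :
  (forall i, psi (var i) - phi (var i) \in mpow 2) ->
  linear_part psi = linear_part phi.
Proof.
move=> h2; apply/matrixP => i j; rewrite !mxE.
have /mpow2P[_ /(_ j)] := h2 i; rewrite scoefB => /eqP.
by rewrite subr_eq0 => /eqP.
Qed.

(** The correction b solves the linearised equation g - phi f = sum b_i phi (d_i f).
    With t = M - q + 1 the quadratic error has order 2 t + s, which exceeds M
    because 2 q <= M + s + 1. *)
Lemma newton_step phi f g s q M :
    f \in mpow s -> {subset mpow q <= ideal_mul (mpow 2) (jacobian f)} ->
    (q <= M)%N -> (q + q <= M + s + 1)%N ->
    linear_part phi \in unitmx -> phi f - g \in mpow M ->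
  exists psi : {lrmorphism R -> R}, psi f - g \in mpow M.+1 /\
    forall i, psi (var i) - phi (var i) \in mpow (M - q + 2).
Proof.
move=> fs qf qM q2 phiU fg.
have [|b [bt bE]] := @pullback_jacobian phi f q (M - q) (g - phi f) phiU qf.
  by rewrite subnK // -rpredN opprB.
have yt i : phi (var i) + b i \in mpow 1.
  rewrite rpredD ?endo_mpow ?var_mpow //; apply: mpow_sub (bt i).
  by rewrite addn2.
have [psi psiE] := exists_endo yt.
have dE i : psi (var i) - phi (var i) = b i by rewrite psiE addrC addKr.
exists psi; split=> [|i]; last by rewrite dE.
have dt i : psi (var i) - phi (var i) \in mpow (M - q).+1.+1.
  by rewrite dE -addn2.
have := taylor2 dt fs; under eq_bigr do rewrite dE.
rewrite -bE opprB addrA subrK; apply: mpow_sub; lia.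
Qed.

(** Finite determinacy. Each step of Newton's method moves the images of the
    variables by elements of m^2, which preserves the linear part, and the order of
    these elements grows with the step, so the images converge. *)
Lemma right_equivalent_of_approx phi f g s q N :
    f \in mpow s -> {subset mpow q <= ideal_mul (mpow 2) (jacobian f)} ->
    (q <= N)%N -> (q + q <= N + s + 1)%N ->
    linear_part phi \in unitmx -> phi f - g \in mpow N ->
  right_equivalent f g.
Proof.
move=> fs qf qN q2 phiU fg.
pose good k psi := linear_part psi \in unitmx /\ psi f - g \in mpow (N + k).
have /choice[F FP] (x : nat * {lrmorphism R -> R}) :
    exists psi : {lrmorphism R -> R}, good x.1 x.2 -> good x.1.+1 psi /\
    forall i, psi (var i) - x.2 (var i) \in mpow x.1.+2.
  case: x => k psi /=; have [[psiU fk]|] := pselect (good k psi); last by exists psi.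
  have [||psi' [psi'f psi'E]] := newton_step fs qf _ _ psiU fk; try lia.
  have dk i : psi' (var i) - psi (var i) \in mpow k.+2.
    by apply: mpow_sub (psi'E i); lia.
  exists psi' => _; split=> //; split; last by rewrite addnS.
  by rewrite (eq_linear_part (fun i => mpow_sub _ (dk i))).
pose P := fix P k := if k is k'.+1 then F (k', P k') else phi.
have Pgood k : good k (P k).
  elim: k => [|k IH]; first by split; rewrite ?addn0.
  by have [] := FP (k, P k) IH.
have Pstep k i : P k.+1 (var i) - P k (var i) \in mpow k.+2.
  by have [_] := FP (k, P k) (Pgood k); apply.
have /choice[y yP] i : exists l, forall d, l - P d (var i) \in mpow d.
  by apply: mpow_complete => d; apply: mpow_sub (Pstep d i); lia.
have y1 i : y i \in mpow 1.
  rewrite -(subrK (P 1%N (var i)) (y i)) rpredD ?yP //.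
  by rewrite endo_mpow ?var_mpow.
have [Phi PhiE] := exists_endo y1.
have PhiP d i : Phi (var i) - P d (var i) \in mpow d by rewrite PhiE.
exists Phi; split.
  (* From index 2 on the iterates agree with their limit modulo m^2. *)
  apply: inverse_function; rewrite (eq_linear_part (PhiP 2)).
  by have [] := Pgood 2.
apply/esym/eqP; rewrite -subr_eq0; apply/eqP/mpow_eq0 => d.
rewrite -(subrK (P d.+1 f) (Phi f)) -addrA rpredD //.
  by apply: mpow_sub (taylor1 (PhiP d.+1) fs); lia.
have [_] := Pgood d.+1; apply: mpow_sub; lia.
Qed.

(** Writing f = psi g, the chain rule expresses d_i f through the psi (d_j g),
    and phi turns these into d_j g. *)
Lemma endo_milnor_ideal phi psi k f g : cancel phi psi -> cancel psi phi ->
  g = phi f -> forall h, h \in milnor_ideal k f -> phi h \in milnor_ideal k g.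
Proof.
move=> phiK psiK gE; apply: ideal_mul_ind => [|x y xk yk|a b ak].
- by rewrite endo0 rpred0.
- by rewrite endoD rpredD.
move=> /jacobian_comb[c ->]; rewrite endoM mem_ideal_mul ?endo_mpow //.
rewrite endo_sum rpred_sum // => i _; rewrite endoM ideal_absorb //.
have -> : f = psi g by rewrite gE phiK.
rewrite chain_rule endo_sum rpred_sum // => j _.
by rewrite endoM psiK mulrC ideal_absorb ?spderiv_jacobian.
Qed.

End Determinacy.

(** * Morphisms between quotient algebras *)
Section Quotients.
Local Open Scope ring_scope.
Variables (K : comNzRingType) (A : comAlgType K).
Implicit Types I J : ideal A.

Lemma quotient_classP I (x y : A) :
  quotient_class I x = quotient_class I y <-> x - y \in I.
Proof. by rewrite Quotient.idealrBE; split=> [/eqP|/eqP]. Qed.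

Lemma quotient_class_ex I (q : quotient_algebra I) :
  exists x, quotient_class I x = q.
Proof. by exists (repr q); rewrite /quotient_class reprK. Qed.

Lemma quotient_classD I (x y : A) :
  quotient_class I (x + y) = quotient_class I x + quotient_class I y.
Proof. exact: Quotient.pi_add. Qed.

Lemma quotient_classB I (x y : A) :
  quotient_class I (x - y) = quotient_class I x - quotient_class I y.
Proof. by apply/eqP; rewrite eq_sym subr_eq -quotient_classD subrK. Qed.

Lemma quotient_class1 I : quotient_class I 1 = 1.
Proof. by []. Qed.

Lemma quotient_class0 I : quotient_class I 0 = 0.
Proof. by rewrite -(subrr 0) quotient_classB subrr. Qed.

Lemma quotient_class_mul I (x y : A) :
  quotient_class I (x * y) = quotient_class I x * quotient_class I y.
Proof. exact: quotient_classM. Qed.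

Lemma quotient_class_scale I c (x : A) :
  quotient_class I (c *: x) = c *: quotient_class I x.
Proof. exact: quotient_classZ. Qed.

Lemma quotient_lrmorph (phi psi : {lrmorphism A -> A}) I J :
    cancel phi psi -> cancel psi phi ->
    (forall x, x \in I -> phi x \in J) -> (forall x, x \in J -> psi x \in I) ->
  exists F : {rmorphism quotient_algebra I -> quotient_algebra J},
    [/\ bijective F, scalable F &
        forall x, F (quotient_class I x) = quotient_class J (phi x)].
Proof.
move=> phiK psiK phiI psiJ.
pose F (q : quotient_algebra I) := quotient_class J (phi (repr q)).
pose G (q : quotient_algebra J) := quotient_class I (psi (repr q)).
have FE x : F (quotient_class I x) = quotient_class J (phi x).
  apply/quotient_classP; rewrite -rmorphB; apply: phiI.
  by apply/quotient_classP; rewrite /quotient_class reprK.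
have GE x : G (quotient_class J x) = quotient_class I (psi x).
  apply/quotient_classP; rewrite -rmorphB; apply: psiJ.
  by apply/quotient_classP; rewrite /quotient_class reprK.
have FB : zmod_morphism F.
  move=> a b; have [[x <-] [y <-]] := (quotient_class_ex a, quotient_class_ex b).
  by rewrite -quotient_classB !FE rmorphB quotient_classB.
have FM : monoid_morphism F.
  split=> [|a b]; first by rewrite -quotient_class1 FE rmorph1.
  have [[x <-] [y <-]] := (quotient_class_ex a, quotient_class_ex b).
  by rewrite -quotient_class_mul !FE rmorphM quotient_class_mul.
pose F' : {rmorphism quotient_algebra I -> quotient_algebra J} := HB.pack F
  (GRing.isZmodMorphism.Build _ _ F FB) (GRing.isMonoidMorphism.Build _ _ F FM).
exists F'; split=> //.
  exists G => q; have [x <-] := quotient_class_ex q.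
    by rewrite /= FE GE phiK.
  by rewrite /= GE FE psiK.
move=> c q; have [x <-] := quotient_class_ex q.
by rewrite -quotient_class_scale /= !FE linearZ quotient_class_scale.
Qed.

End Quotients.

(** * Lifting isomorphisms of quotients to K[[x]] *)
Section Lift.
Local Open Scope ring_scope.
Variables (n : nat) (K : fieldType).
Local Notation R := (mseries n K).
Local Notation mpow := (ideal_exp (maxideal n K)).
Implicit Types (f g h u v w : R) (phi psi : {lrmorphism R -> R}).
Variables (I J : ideal R).
Variable F : {rmorphism quotient_algebra I -> quotient_algebra J}.
Hypotheses (F_bij : bijective F) (F_scal : scalable F).

(** The quotient R / J is not zero, so a unit of R cannot be sent to the class
    of a non-unit; and h is in m exactly when h - c is a unit for all c <> 0. *)
Lemma quotient_iso_local h v : {subset J <= mpow 1} ->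
  F (quotient_class I h) = quotient_class J v -> (v \in mpow 1) = (h \in mpow 1).
Proof.
move=> J1.
have unitF u w : F (quotient_class I u) = quotient_class J w ->
    u \notin mpow 1 -> w \notin mpow 1.
  rewrite mpow1 => uw /series_unit[u' uu']; apply/negP => w1.
  have [w' w'E] := quotient_class_ex (F (quotient_class I u')).
  have : w * w' - 1 \in J.
    apply/quotient_classP.
    by rewrite quotient_class_mul w'E -uw -rmorphM -quotient_class_mul uu' rmorph1.
  move/J1; rewrite rpredBl; last by rewrite mulrC mpow_mull.
  by rewrite mpow1 /= eqxx oner_eq0.
move=> hv; apply/idP/idP; last first.
  move=> h1; rewrite -(subrK (scoef v 0%MM *: 1) v); set c := scoef v _.
  have [c0|c0] := eqVneq c 0; first by rewrite c0 scale0r addr0 subr0 mpow1 -/c c0.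
  have h0 : h - c *: 1 \notin mpow 1 by rewrite rpredBl // mpow1 /= eqxx mulr1.
  have /negP[] : v - c *: 1 \notin mpow 1; last by rewrite mpow1 /= eqxx mulr1 subrr.
  apply: unitF h0; rewrite !quotient_classB rmorphB hv !quotient_class_scale.
  by rewrite F_scal rmorph1.
by move=> v1; apply/negPn/negP => h1; have /negP[] := unitF _ _ hv h1.
Qed.

(** Lifts y_i of the images of the variables define phi. The maps h |-> F [h] and
    h |-> [phi h] agree on monomials; to extend this by density, J must contain a
    power of m, which it inherits from I through F. Since J <= m^2, surjectivity of F
    makes the linear part of phi invertible. Finally phi f - g lies in J, and the
    surjectivity of phi turns the inclusion I <= m^c into J <= m^c. *)
Lemma quotient_iso_lift d c f g :
    {subset mpow d <= I} -> {subset I <= mpow c} -> {subset J <= mpow 2} ->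
    F (quotient_class I f) = quotient_class J g ->
  exists phi : {lrmorphism R -> R},
    linear_part phi \in unitmx /\ phi f - g \in mpow c.
Proof.
move=> dI Ic J2 Ffg.
have J1 : {subset J <= mpow 1} by move=> x /J2; apply: mpow_sub.
have [G FK GK] := F_bij.
have lift w : exists v, F (quotient_class I v) = quotient_class J w.
  have [v vE] := quotient_class_ex (G (quotient_class J w)).
  by exists v; rewrite vE GK.
have dJ : {subset mpow d <= J}.
  have lift_mpow e w : w \in mpow e ->
      exists2 v, v \in mpow e & F (quotient_class I v) = quotient_class J w.
    elim: e w => [|e IH] w; first by have [v vw] := lift w; exists v; rewrite ?mpow0.
    apply: (@ideal_mul_ind _ _ _ (fun w =>
      exists2 v, v \in mpow e.+1 & F (quotient_class I v) = quotient_class J w)).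
    - by exists 0; rewrite ?rpred0 // !quotient_class0 rmorph0.
    - move=> x y [v v1 vx] [w' w1 wy]; exists (v + w'); first by rewrite rpredD.
      by rewrite !quotient_classD rmorphD vx wy.
    move=> a b; rewrite mem_maxideal -mpow1 => a1 /IH[v ve vb].
    have [u ua] := lift a; exists (u * v).
      by rewrite -add1n mpow_mul // -(quotient_iso_local J1 ua).
    by rewrite !quotient_class_mul rmorphM ua vb.
  move=> w /lift_mpow[v /dI vI vw]; rewrite -[w]subr0; apply/quotient_classP.
  rewrite -vw quotient_class0 -(rmorph0 F); congr (F _).
  by rewrite -quotient_class0; apply/quotient_classP; rewrite subr0.
have /choice[y yP] i : exists y, F (quotient_class I (var i)) = quotient_class J y.
  by have [y yE] := quotient_class_ex (F (quotient_class I (var i))); exists y.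
have y1 i : y i \in mpow 1 by rewrite (quotient_iso_local J1 (yP i)) var_mpow.
have [phi phiE] := exists_endo y1.
have Fphi h : F (quotient_class I h) = quotient_class J (phi h).
  apply: (@mpow_ind _ _ 0 d (fun h =>
    F (quotient_class I h) = quotient_class J (phi h))); last exact: mpow0.
  - move=> u ud; have -> : quotient_class I u = 0.
      by rewrite -quotient_class0; apply/quotient_classP; rewrite subr0 dI.
    rewrite rmorph0 -quotient_class0; apply/esym/quotient_classP.
    by rewrite subr0 dJ ?endo_mpow.
  - by move=> u v uE vE; rewrite endoD !quotient_classD rmorphD uE vE.
  - by move=> a u uE; rewrite endoZ !quotient_class_scale F_scal uE.
  move=> a _; elim/mono_ind: a => [|i a IH].
    by rewrite mono0 endo1 !quotient_class1 rmorph1.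
  by rewrite monoD endoM !quotient_class_mul rmorphM IH yP phiE.
have phiU : linear_part phi \in unitmx.
  have /choice[z zP] i : exists z, F (quotient_class I z) = quotient_class J (var i).
    exact: lift.
  have z1 i : z i \in mpow 1 by rewrite -(quotient_iso_local J1 (zP i)) var_mpow.
  pose Z : 'M[K]_n := \matrix_(i, j) scoef (z i) U_(j)%MM.
  suff /mulmx1_unit[_ ?] : Z *m linear_part phi = 1%:M by [].
  apply/matrixP => i j; rewrite mxE [RHS]mxE.
  have : phi (z i) - var i \in mpow 2.
    by apply: J2; apply/quotient_classP; rewrite -Fphi zP.
  move/mpow2P=> [_ /(_ j)/eqP]; rewrite scoefB scoef_mono eq_mnm1 subr_eq0 => /eqP<-.
  by rewrite scoef_endo //; apply: eq_bigr => l _; rewrite mxE.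
exists phi; split=> //.
(* phi f - g = phi v with v in I, since phi f - g has class zero. *)
have [v _ vE] := mpow_surj phiU (mpow0 (phi f - g)).
rewrite -vE endo_mpow // Ic // -[v]subr0; apply/quotient_classP.
apply: (can_inj FK); rewrite Fphi vE quotient_classB -Fphi Ffg subrr.
by rewrite quotient_class0 rmorph0.
Qed.

End Lift.

(** * Ideals of finite codimension *)
Section FiniteMilnor.
Local Open Scope ring_scope.
Variables (n : nat) (K : fieldType).
Local Notation R := (mseries n K).
Local Notation mpow := (ideal_exp (maxideal n K)).
Implicit Types (f g h u v w : R).

(** The induction runs on the statement multiplied by an arbitrary w, which
    collects the variables that have been split off. *)
Lemma mpow_gen (J : ideal R) d : (forall a, mdeg a = d -> mono a \in J) ->
  {subset mpow d <= J}.
Proof.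
move=> dJ h hd; rewrite -[h]mulr1.
have {}dJ (a : 'X_{1..n}) : mdeg a = d -> mono a * 1 \in J.
  by move=> /dJ; rewrite mulr1.
move: dJ; move: (1 : R) => w.
elim: d h hd w => [|d IH] h hd w dJ.
  by apply: ideal_absorb; rewrite -[w]mul1r -mono0 dJ // mdeg0.
have [p [pd ->]] := mpow_vars hd; rewrite mulr_suml rpred_sum // => i _.
rewrite (mulrC (var i)) -mulrA; apply: IH => // a ad.
by rewrite mulrA (mulrC (mono a)) -monoD dJ // mdegD mdeg1 ad.
Qed.

Lemma finite_dim_dep (V : lmodType K) d (x : 'I_d.+1 -> V) : has_dimension V d ->
  exists u : 'rV[K]_d.+1, u != 0 /\ \sum_l u 0 l *: x l = 0.
Proof.
move=> [e eP].
have /choice[c cP] l : exists c : {ffun 'I_d -> K}, x l = \sum_i c i *: e i.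
  by have [c [cE _]] := eP (x l); exists c.
pose M : 'M[K]_(d.+1, d) := \matrix_(l, i) c l i.
exists (nz_row (kermx M)); split.
  rewrite nz_row_eq0 kermx_eq0 /row_free neq_ltn.
  by rewrite (leq_ltn_trans (rank_leq_col M)).
have /sub_kermxP uM : (nz_row (kermx M) <= kermx M)%MS by apply: nz_row_sub.
under eq_bigr => l _ do rewrite cP scaler_sumr.
rewrite exchange_big /= big1 // => i _.
under eq_bigr => l _ do rewrite scalerA.
rewrite -scaler_suml; move/(congr1 (fun A : 'rV_d => A 0 i)): uM.
rewrite !mxE => uM; rewrite -[RHS](scale0r (e i)) -[in RHS]uM; congr (_ *: _).
by apply: eq_bigr => l _; rewrite mxE.
Qed.

(** The powers 1, x, ..., x^d are linearly dependent modulo J, so J contains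
    x^r times a unit, where r <= d is the least exponent of the relation. *)
Lemma var_exp_mem (J : ideal R) d (i : 'I_n) :
  has_dimension (quotient_algebra J) d -> var i ^+ d \in J.
Proof.
move=> /(finite_dim_dep (fun l => quotient_class J (var i ^+ l)))[u [u0 uE]].
have uJ : \sum_l u 0 l *: var i ^+ l \in J.
  rewrite -[\sum_l _]subr0; apply/quotient_classP; rewrite quotient_class0 -[RHS]uE.
  rewrite (big_morph _ (quotient_classD J) (quotient_class0 J)).
  by apply: eq_bigr => l _; rewrite quotient_class_scale.
have [l0 l0P] : exists l, u 0 l != 0.
  apply: contrapT => /forallNP u0'; case/eqP: u0; apply/rowP => l; rewrite mxE.
  by apply/eqP/negPn/negP/u0'.
case: (@arg_minnP _ l0 (fun l => u 0 l != 0) (@nat_of_ord _) l0P) => r ur rmin.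
pose w := \sum_(l < d.+1) u 0 l *: (if (r <= l)%N then var i ^+ (l - r) else 0).
have rw : \sum_l u 0 l *: var i ^+ l = var i ^+ r * w.
  rewrite mulr_sumr; apply: eq_bigr => l _; rewrite -scalerAr.
  case: ifPn => [rl|]; first by rewrite -exprD subnKC.
  rewrite mulr0; case: (eqVneq (u 0 l) 0) => [->|/rmin->//].
  by rewrite !scale0r.
have [|w' ww'] := @series_unit _ _ w.
  rewrite /w scoef_sum (bigD1 r) //= leqnn subnn expr0 /= eqxx mulr1.
  rewrite big1 ?addr0 // => l lr; case: ifP => [rl|_]; last by rewrite mulr0.
  have : var i ^+ (l - r) \in mpow 1.
    have rl' : (r < l)%N.
      by rewrite ltn_neqAle rl andbT eq_sym; move: lr; rewrite -val_eqE.
    by rewrite -(subnSK rl') exprS mulrC mpow_mull ?var_mpow.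
  by rewrite mpow1 => /eqP->; rewrite mulr0.
have rd : (r <= d)%N by rewrite -ltnS.
rewrite -(subnK rd) exprD ideal_absorb //.
by rewrite -[_ ^+ r]mulr1 -ww' mulrA -rw mulrC ideal_absorb.
Qed.

(** Pigeonhole: a monomial of degree greater than n d is divisible by some x_i^d. *)
Lemma mpow_sub_of_finite_dim (J : ideal R) d :
  has_dimension (quotient_algebra J) d -> {subset mpow (n * d).+1 <= J}.
Proof.
move=> dimJ; apply: mpow_gen => a ad.
have [i ai] : exists i, (d <= a i)%N.
  apply: contrapT => /forallNP ad'; suff : (mdeg a <= n * d)%N by rewrite ad ltnn.
  rewrite mdegE -[n in (n * d)%N]card_ord -sum_nat_const leq_sum // => i _.
  by rewrite ltnW // ltnNge; apply/negP/ad'.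
have da : (U_(i) *+ d <= a)%MM.
  apply/mnm_lepP => j; rewrite mulmnE mnm1E.
  by case: eqP => [<-|]; rewrite ?mul1n ?mul0n.
rewrite -(submK da) monoD ideal_absorb //.
by rewrite /mono -mpolyXn rmorphXn /= var_exp_mem.
Qed.

End FiniteMilnor.

(** * The equivalence *)
Section Main.
Local Open Scope ring_scope.
Variables (n : nat) (K : fieldType).
Local Notation R := (mseries n K).
Local Notation mpow := (ideal_exp (maxideal n K)).
Implicit Types (f g h u v w : R) (phi psi : {lrmorphism R -> R}).

Lemma milnor_of_right_equivalent f g k :
  right_equivalent f g -> milnor_isomorphic k f g.
Proof.
move=> [phi [/endo_inv[psi [phiK psiK]] gE]].
have fE : f = psi g by rewrite gE phiK.
have [F [Fbij Fscal FE]] := quotient_lrmorph phiK psiK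
  (endo_milnor_ideal phiK psiK gE (k:=k)) (endo_milnor_ideal psiK phiK fE (k:=k)).
by exists F; split=> //; rewrite [LHS]FE -gE.
Qed.

Lemma mpow_sub_leq (i : 'I_n) d e : {subset mpow d <= mpow e} -> (e <= d)%N.
Proof.
move=> de; rewrite leqNgt; apply/negP => lt_de.
have dX : mdeg (U_(i) *+ d)%MM = d by rewrite mdegMn mdeg1 mul1n.
have /de/mpowP/(_ (U_(i) *+ d)%MM) : mono (U_(i) *+ d)%MM \in mpow d.
  by rewrite -{2}dX mono_mpow.
by rewrite dX scoef_mono eqxx => /(_ lt_de)/eqP; rewrite oner_eq0.
Qed.

Lemma jacobian_sub_mpow f s : f \in mpow s -> {subset jacobian f <= mpow s.-1}.
Proof.
move=> fs; apply: ideal_gen_sub => _ [i _ <-].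
by case: s fs => [|s] fs; [apply: mpow0 | apply: spderiv_mpow].
Qed.

(** Without variables every series of positive order vanishes and has no order. *)
Lemma has_order_var f s : has_order f s -> (0 < s)%N -> exists i : 'I_n, True.
Proof.
case: (posnP n) => [n0|n_gt0]; last by exists (Ordinal n_gt0).
move=> [fs smax] s0; suff /smax : f \in mpow s.+1 by rewrite ltnn.
apply/mpowP => a _; have /mpowP-> // := fs.
by rewrite mdegE big1 // => i; have := ltn_ord i; rewrite {2}n0.
Qed.

Lemma milnor_ideal_sub_mpow k f t : {subset jacobian f <= mpow t} ->
  {subset milnor_ideal k f <= mpow (k + t)}.
Proof. by move=> ft; apply: ideal_mul_sub => a b ak /ft bt; apply: mpow_mul. Qed.

Lemma mpow_sub_mul k d (J : ideal R) : {subset mpow d <= J} ->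
  {subset mpow (k + d) <= ideal_mul (mpow k) J}.
Proof.
move=> dJ x /mpow_split; apply: ideal_mul_sub => a b ak /dJ.
exact: mem_ideal_mul.
Qed.

Lemma right_equivalent_of_milnor f g s s' k :
    has_order f s -> (2 <= s)%N ->
    (exists mu : nat, has_milnor_number f mu) ->
    has_ideal_order (jacobian f) s' ->
    {subset mpow ((k + s + s' + 1) %/ 2) <= ideal_mul (mpow 2) (jacobian f)} ->
    milnor_isomorphic k f g ->
  right_equivalent f g.
Proof.
move=> ford s2 [mu /mpow_sub_of_finite_dim Ncol] [js' s'max].
set q := (_ %/ 2)%N => qf [F [Fbij Fscal Ffg]].
have [i _] := has_order_var ford (ltnW s2).
have ss' : (s.-1 <= s')%N by apply/s'max/jacobian_sub_mpow; case: ford.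
have qs' : (s' + 2 <= q)%N.
  apply: (mpow_sub_leq i) => x /qf; rewrite addnC; exact: (@milnor_ideal_sub_mpow 2).
(* s' + 2 <= q <= (k + s + s' + 1) / 2 and s <= s' + 1. *)
have k2 : (2 <= k)%N by move: qs'; rewrite /q; lia.
have gJ2 : {subset milnor_ideal k g <= mpow 2}.
  move=> x /(milnor_ideal_sub_mpow (fun y _ => mpow0 y)).
  by apply: mpow_sub; rewrite addn0.
have [phi [phiU phifg]] := quotient_iso_lift Fbij Fscal
  (mpow_sub_mul Ncol) (milnor_ideal_sub_mpow js') gJ2 Ffg.
by apply: (right_equivalent_of_approx ford.1 qf _ _ phiU phifg); rewrite /q; lia.
Qed.

Lemma exists_admissible f c : (exists mu : nat, has_milnor_number f mu) ->
  exists k, {subset mpow ((k + c + 1) %/ 2) <= ideal_mul (mpow 2) (jacobian f)}.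
Proof.
move=> [mu /mpow_sub_of_finite_dim Ncol]; exists (2 * (2 + (n * mu).+1))%N.
move=> x xk; apply: (mpow_sub_mul Ncol); apply: mpow_sub xk; lia.
Qed.
End Main.

Theorem theorem2p4 (K : closedFieldType) (n : nat) (f g : mseries n K)
    (s s' : nat)
    (ord_f : has_order f s) (s_ge2 : (2 <= s)%N)
    (mu_f_finite : exists mu : nat, has_milnor_number f mu)
    (ord_jf : has_ideal_order (jacobian f) s') :
  let admissible (k : nat) : Prop :=
    {subset ideal_exp (maxideal n K) ((k + s + s' + 1) %/ 2)%N
     <= ideal_mul (ideal_exp (maxideal n K) 2) (jacobian f)} in
  (right_equivalent f g <->
     exists k : nat, admissible k /\ milnor_isomorphic k f g) /\
  (right_equivalent f g <->
     forall k : nat, admissible k -> milnor_isomorphic k f g).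
Proof.
move=> admissible.
have [k0 k0P] := exists_admissible (s + s') mu_f_finite.
have {}k0P : admissible k0 by rewrite /admissible -(addnA k0).
have back k : admissible k -> milnor_isomorphic k f g -> right_equivalent f g.
  exact: right_equivalent_of_milnor.
split; split.
- by move=> fg; exists k0; split=> //; apply: milnor_of_right_equivalent.
- by move=> [k [kP fg]]; apply: back fg.
- by move=> fg k _; apply: milnor_of_right_equivalent.
- by move=> all; apply: back (all k0 k0P).
Qed.
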